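(* Let $\nu\in\mathbb{R}$, $t>0$ and $n\in\mathbb{N}$. The orthogonal polynomials $P_n^\nu$ satisfy the following recurrence relation: $$ \left[ A_{n+1}^2(t) + \frac{b_{n+1}(t)}{a_{n+1}(t)} + \frac{x}{2} \left[B_{n}(t)-\nu-1-2n\right] \right] \left[ A_{n+1} (t) P_{n+1}^\nu(x,t)+ A_n(t) P_{n-1}^\nu(x,t)\right] $$ $$+ \bigg[x t B'_n(t)+ A^2_{n} (t) \left[B_{n-1}(t)-\nu+1-2n\right] - A^2_{n+1}(t) \left[ B_{n+1}(t)-\nu-3-2n\right] $$ $$ - \left(x- B_n(t) \right) \left[ A_n^2(t) + \frac{b_n(t)}{a_n(t)} + \frac{x}{2} \left[B_n(t)-\nu-1-2n\right] \right]\bigg] P_{n}^\nu(x,t)= 0.$$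
   Context: $\mathbb{N}=\{1,2,\dots\}$, $\mathbb{N}_0=\{0,1,2,\dots\}$. For $\nu\in\mathbb{R}$, $t>0$, $\{P_n^\nu(x,t)\}_{n\ge 0}$ is the sequence of polynomials in $x$ with $P_n^\nu$ of degree exactly $n$ and $\int_0^\infty P_n^\nu(x,t)P_m^\nu(x,t)e^{-x-t/x}x^\nu dx=\delta_{n,m}$ for $n,m\in\mathbb{N}_0$; the sign is fixed so that the leading coefficient has sign $(-1)^n$. Write $P_n^\nu(x,t)=\sum_{k=0}^n a_{n,k}(t)x^k$, $a_n(t)=a_{n,n}(t)\neq0$, $b_n(t)=a_{n,n-1}(t)$ (with $b_0=0$). Put $A_n(t)=a_{n-1}(t)/a_n(t)$ for $n\ge1$, and $B_n(t)=\frac{b_n(t)}{a_n(t)}-\frac{b_{n+1}(t)}{a_{n+1}(t)}$ for $n\ge 0$; these are the coefficients in the three term recurrence $xP_n^\nu=A_{n+1}P_{n+1}^\nu+B_nP_n^\nu+A_nP_{n-1}^\nu$ (with $P_{-1}^\nu\equiv0$). The coefficients $a_{n,k}(t)$ are regarded as continuously differentiable functions of $t>0$; primes denote $d/dt$. *)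

(* Defs.v *)
From HB Require Import structures.
From mathcomp Require Export all_boot all_order all_algebra.
From mathcomp Require Export all_classical all_reals all_analysis.

Set Implicit Arguments.
Unset Strict Implicit.
Unset Printing Implicit Defensive.

Export Order.TTheory GRing.Theory Num.Theory.
Export numFieldNormedType.Exports.

Local Open Scope classical_set_scope.
Local Open Scope ring_scope.

Definition weight (R : realType) (nu t x : R) : R :=
  expR (- x - t / x) * x `^ nu.

(* [P n t] is the polynomial x |-> P_n^nu(x,t); nothing is required of it when
   t <= 0. The integral is extended-real valued, so the last clause also says
   that it is finite. *)
Definition orthonormal_family (R : realType) (nu : R)
    (P : nat -> R -> {poly R}) : Prop :=
  forall t : R, 0 < t ->
    [/\ forall n : nat, size (P n t) = n.+1,
        forall n : nat, 0 < (-1) ^+ n * lead_coef (P n t)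
      & forall n m : nat,
          (\int[lebesgue_measure]_(x in `]0%R, +oo[)
             ((P n t).[x] * (P m t).[x] * weight nu t x)%:E
           = ((n == m)%:R)%:E)%E].

Definition C1_coefficients (R : realType) (P : nat -> R -> {poly R}) : Prop :=
  forall n k : nat, forall t : R, 0 < t ->
    derivable (fun s : R => (P n s)`_k) t 1 /\
    {for t, continuous ((fun s : R => (P n s)`_k)^`())%classic}.

Section Coefficients.
Variables (R : realType) (P : nat -> R -> {poly R}).

Definition coef_a (n : nat) (t : R) : R := (P n t)`_n.

Definition coef_b (n : nat) (t : R) : R :=
  if n is k.+1 then (P n t)`_k else 0.

(* Only meaningful for n >= 1: the value at n = 0 is an artefact of 0.-1 = 0. *)
Definition coef_A (n : nat) (t : R) : R := coef_a n.-1 t / coef_a n t.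

Definition coef_B (n : nat) (t : R) : R :=
  coef_b n t / coef_a n t - coef_b n.+1 t / coef_a n.+1 t.

End Coefficients.

(* Main.v *)
From HB Require Import structures.
Require Import Defs.
From mathcomp Require Import ring lra zify measurable_realfun.

(** By the three term recurrence, A_(n+1) P_(n+1) + A_n P_(n-1) equals
    (x - B_n) P_n, so the left-hand side of the theorem is P_n times a
    polynomial of degree at most 1 in x whose quadratic part has cancelled.
    Since b_n/a_n - b_(n+1)/a_(n+1) = B_n, its two coefficients vanish exactly
    when two scalar identities hold:

    - the Toda equation  t B_n' = B_n + A_n^2 - A_(n+1)^2;
    - the string equation
        A_(n+1)^2 (B_(n+1) + B_n - nu - 3 - 2n)
          - A_n^2 (B_n + B_(n-1) - nu + 1 - 2n) = B_n^2.

    Both come from one integration by parts. Write L_t(q) for the integral of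
    q times the weight w_t over the half-line. Since
    (x q w_t)' = (D q + t q / x) w_t  with  D q = (nu + 1) q + x q' - x q,
    and since x q w_t vanishes at both ends, L_t(D q) = - t L_t(q/x)
    ([pairing_by_parts]).

    Replacing q by x q removes the singular term and gives the Pearson equation
    L_t(2 x q + x^2 q' + (-x^2 + nu x + t) q) = 0 ([pairing_pearson]). Applied
    to q = P_n P_(n-1), it expresses L_t(x^2 P_n' P_(n-1)) through the
    recurrence coefficients. The derivative of the three term recurrence
    evaluates in another way the difference of A_n L_t(x^2 P_n' P_(n-1)) for
    n + 1 and n ([deriv_recurrence]), and comparing the two yields
    [string_equation].

    On the other hand the weight satisfies dw_t/dt = - w_t/x, so
    t d/dt L_t(q) = L_t(D q) ([derive_pairing]). Differentiating the
    orthogonality relation L_s(P_n(s) P_(n-1)(t)) = 0 at s = t gives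
    [toda_equation], an equation for the derivative of b_n/a_n, and the
    difference for n and n + 1 is the Toda equation.

    All integrals converge because the orthonormality relations themselves say
    that each P_n^2 w_t is integrable ([orthonormal_finite_moments]); the term
    q/x is absorbed by decreasing the parameter, as w_t/x is at most a constant
    times w_s when s < t ([weight_div_le]). *)

Set Implicit Arguments.
Unset Strict Implicit.
Unset Printing Implicit Defensive.

Local Open Scope classical_set_scope.
Local Open Scope ring_scope.

(** * Orthonormal polynomials for a linear functional *)

Section JacobiCoefficients.
Variables (R : fieldType) (p : nat -> {poly R}).

(** [offdiag] and [diag] are the off-diagonal and diagonal entries A_n and B_n
    of the Jacobi matrix of the sequence [p]; as there, [offdiag] is meaningful
    for [n >= 1] only. *)
Definition offdiag (n : nat) : R := (p n.-1)`_n.-1 / (p n)`_n.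

Definition subratio (n : nat) : R :=
  (if n is k.+1 then (p n)`_k else 0) / (p n)`_n.

Definition diag (n : nat) : R := subratio n - subratio n.+1.

End JacobiCoefficients.

(** The adjoint of - x d/dx with respect to the Laguerre weight x^nu e^(-x):
    (x q w)' = [laguerre_op nu q] w when w is that weight. *)
Definition laguerre_op (R : nzRingType) (nu : R) (q : {poly R}) : {poly R} :=
  (nu + 1) *: q + 'X * q^`() - 'X * q.

Section Orthonormal.
Variables (R : realFieldType) (L : {scalar {poly R}}) (p : nat -> {poly R}).
Hypothesis size_p : forall n, size (p n) = n.+1.
Hypothesis Lpp : forall n m, L (p n * p m) = (n == m)%:R.

Local Notation A := (offdiag p).
Local Notation beta := (subratio p).
Local Notation B := (diag p).

Lemma LmulZ (q r : {poly R}) c : L (q * (c *: r)) = c * L (q * r).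
Proof. by rewrite -scalerAr linearZ. Qed.

Lemma lead_neq0 n : (p n)`_n != 0.
Proof.
rewrite -[X in _`_X]/(n.+1.-1) -size_p -lead_coefE lead_coef_eq0.
by rewrite -size_poly_eq0 size_p.
Qed.

Lemma size_sub_top (q : {poly R}) n : (size q <= n.+1)%N ->
  (size (q - (q`_n / (p n)`_n) *: p n)%R <= n)%N.
Proof.
move=> szq; apply/leq_sizeP => j; rewrite leq_eqVlt => /predU1P[<-|nj].
  by rewrite coefB coefZ divfK ?lead_neq0// subrr.
rewrite coefB coefZ [(p n)`_j]nth_default ?size_p// mulr0 subr0.
by rewrite nth_default// (leq_trans szq).
Qed.

Lemma ortho_low n (q : {poly R}) : (size q <= n)%N -> L (p n * q) = 0.
Proof.
suff H k : (k <= n)%N ->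
    forall r : {poly R}, (size r <= k)%N -> L (p n * r) = 0 by apply: H.
elim: k => [_ r|k IH kn r szr].
  by rewrite leqn0 size_poly_eq0 => /eqP ->; rewrite mulr0 linear0.
rewrite -[r](subrK ((r`_k / (p k)`_k) *: p k)) mulrDr linearD/=.
rewrite IH ?size_sub_top// ?(ltnW kn)// add0r LmulZ Lpp.
by rewrite gtn_eqF ?mulr0.
Qed.

Lemma ortho_top n (q : {poly R}) : (size q <= n.+1)%N ->
  L (p n * q) = q`_n / (p n)`_n.
Proof.
move=> szq; rewrite -[in LHS](subrK ((q`_n / (p n)`_n) *: p n) q).
rewrite mulrDr linearD/=.
by rewrite ortho_low ?size_sub_top// LmulZ Lpp eqxx add0r mulr1.
Qed.

(** Every value of [L] below reduces to this formula: a polynomial of degree at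
    most [n + 1] is paired with [p n] by reading off its two top coefficients,
    as subtracting the right multiple of [p n.+1] kills the top one. *)
Lemma ortho_top2 n (q : {poly R}) : (size q <= n.+2)%N ->
  L (p n * q) = (q`_n - q`_n.+1 * beta n.+1) / (p n)`_n.
Proof.
move=> szq.
rewrite -[in LHS](subrK ((q`_n.+1 / (p n.+1)`_n.+1) *: p n.+1) q).
rewrite mulrDr linearD/=.
rewrite [X in X + _]ortho_top ?size_sub_top// LmulZ Lpp ltn_eqF// mulr0 addr0.
by rewrite coefB coefZ mulrAC mulrA.
Qed.

Lemma ortho_eq0 n (q : {poly R}) : (size q <= n)%N ->
  (forall m, (m < n)%N -> L (p m * q) = 0) -> q = 0.
Proof.
elim: n => [|n IH] szq Lq; first by apply/eqP; rewrite -size_poly_eq0 -leqn0.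
apply: IH => [|m mn]; last by apply: Lq; exact: ltnW.
have /eqP := Lq _ (ltnSn n).
rewrite ortho_top// mulf_eq0 invr_eq0 (negbTE (lead_neq0 _)) orbF => /eqP q0.
apply/leq_sizeP => j; rewrite leq_eqVlt => /predU1P[<-//|nj].
by rewrite nth_default// (leq_trans szq).
Qed.

Lemma size_Xp n : size ('X * p n) = n.+2.
Proof. by rewrite mulrC size_mulX -?size_poly_eq0 size_p. Qed.

Lemma LXpp n : L ('X * p n * p n) = B n.
Proof.
rewrite mulrC ortho_top2 ?size_Xp// !coefXM/= /diag mulrBl mulrAC.
rewrite divff ?lead_neq0//.
by rewrite mul1r; case: n.
Qed.

Lemma LXpp_succ n : L ('X * p n.+1 * p n) = A n.+1.
Proof. by rewrite mulrAC mulrC ortho_top ?size_Xp// coefXM. Qed.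

Lemma LXpp_pred n : (0 < n)%N -> L ('X * p n * p n.-1) = A n.
Proof. by case: n => // n _; exact: LXpp_succ. Qed.

(** The two top coefficients of the difference of the two sides cancel by the
    definition of [offdiag] and [diag]; what remains has degree less than [n]
    and is orthogonal to [p 0], ..., [p n.-1]. *)
Lemma three_term n : (0 < n)%N ->
  'X * p n = A n.+1 *: p n.+1 + B n *: p n + A n *: p n.-1.
Proof.
case: n => // n _; apply/eqP; rewrite -subr_eq0; apply/eqP.
have a1 := lead_neq0 n.+1; have a2 := lead_neq0 n.+2.
apply: (@ortho_eq0 n.+1) => [|m mn].
  apply/leq_sizeP => j; rewrite !(coefB, coefD, coefZ, coefXM).
  rewrite /diag /offdiag /subratio /=.
  rewrite leq_eqVlt => /predU1P[<-|]/=.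
    by rewrite [(p n)`_n.+1]nth_default ?size_p//; field; rewrite a1.
  rewrite leq_eqVlt => /predU1P[<-|]/=.
    rewrite [(p n)`_n.+2]nth_default ?size_p//.
    rewrite [(p n.+1)`_n.+2]nth_default ?size_p//.
    by field; rewrite a1.
  case: j => // j nj.
  rewrite [(p n)`_j.+1]nth_default ?size_p; last by lia.
  rewrite [(p n.+1)`_j.+1]nth_default ?size_p; last by lia.
  rewrite [(p n.+2)`_j.+1]nth_default ?size_p; last by lia.
  rewrite [(p n.+1)`_j]nth_default ?size_p; last by lia.
  by rewrite !mulr0 !addr0 subr0.
rewrite mulrBr linearB/= !mulrDr !linearD/= !LmulZ !Lpp.
rewrite [m == n.+2]ltn_eqF ?[m == n.+1]ltn_eqF ?(leqW mn)// !mulr0 oppr0 !add0r.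
rewrite mulrC; move: mn; rewrite ltnS leq_eqVlt => /predU1P[->|mn].
  by rewrite LXpp_succ eqxx mulr1 subrr.
rewrite ltn_eqF// mulr0 subr0 mulrAC mulrC ortho_low// size_Xp; lia.
Qed.

Lemma LX2pp n : (0 < n)%N ->
  L ('X^2 * (p n * p n)) = A n.+1 ^+ 2 + B n ^+ 2 + A n ^+ 2.
Proof.
move=> n0; have -> : 'X^2 * (p n * p n) = ('X * p n) * ('X * p n) by ring.
rewrite {2}three_term// !mulrDr !linearD/= !LmulZ LXpp LXpp_pred//.
by rewrite ['X * p n * p n.+1]mulrAC LXpp_succ -!expr2.
Qed.

Lemma LX2pp_pred n : (0 < n)%N ->
  L ('X^2 * (p n * p n.-1)) = A n * (B n + B n.-1).
Proof.
move=> n0; have -> : 'X^2 * (p n * p n.-1) = ('X * p n.-1) * ('X * p n) by ring.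
rewrite [X in L (_ * X)]three_term// 2![in LHS]mulrDr !linearD/= !LmulZ LXpp.
rewrite ['X * _ * p n.+1]mulrC ortho_low ?size_Xp ?prednK// mulr0 add0r.
rewrite ['X * p n.-1 * p n]mulrAC LXpp_pred//; ring.
Qed.

Lemma size_Xn_deriv k n : (size ('X^k * (p n)^`())%R <= k + n)%N.
Proof.
rewrite (leq_trans (size_polyMleq _ _))// size_polyXn addSn leq_add2l.
have : (size (p n)^`() < size (p n))%N.
  by rewrite lt_size_deriv -?size_poly_eq0 ?size_p.
by rewrite size_p.
Qed.

Lemma LX2deriv_top n : L ('X^2 * (p n)^`() * p n.+1) = n%:R * A n.+1.
Proof.
rewrite mulrC ortho_top ?(size_Xn_deriv 2)// coefXnM/= subn2/= coef_deriv.
rewrite /offdiag; case: n => [|n] /=; first by rewrite !mul0r.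
by rewrite mulrA mulr_natl.
Qed.

Let I n := L ('X^2 * (p n)^`() * p n.-1).

(** Expand [L (X^2 p_n' (X p_n))] directly by the three term recurrence, and
    compare with the derivative of that recurrence paired with [X^2 p_n]. The
    term [B_n L (X^2 p_n' p_n)], which would involve deeper coefficients of
    [p_n], occurs on both sides and cancels. *)
Lemma deriv_recurrence n : (0 < n)%N ->
  A n.+1 * I n.+1 - A n * I n
  = n%:R * A n.+1 ^+ 2 - (n%:R - 1) * A n ^+ 2
    + (A n.+1 ^+ 2 + B n ^+ 2 + A n ^+ 2).
Proof.
move=> n0.
have e1 : L ('X^2 * (p n * p n)) + L ('X^2 * (p n)^`() * ('X * p n))
        = L ('X^2 * p n * ('X * p n)^`()).
  by rewrite -linearD/= derivM derivX; congr (L _); ring.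
have e2 : L ('X^2 * (p n)^`() * ('X * p n)) = A n.+1 * (n%:R * A n.+1)
   + B n * L ('X^2 * (p n)^`() * p n) + A n * I n.
  by rewrite three_term// !mulrDr !linearD/= !LmulZ LX2deriv_top.
have e3 : L ('X^2 * p n * ('X * p n)^`()) = A n.+1 * I n.+1
   + B n * L ('X^2 * (p n)^`() * p n) + A n * ((n%:R - 1) * A n).
  rewrite three_term// !derivD !derivZ !mulrDr !linearD/= !LmulZ /I/=.
  rewrite ![_ * p n * _]mulrAC; congr (_ + _ * _).
  by case: n n0 {e1 e2} => // n _; rewrite LX2deriv_top -[n.+1%:R]natr1 addrK.
by move: e1; rewrite e2 e3 LX2pp//; lra.
Qed.

(** The Pearson equation for [f = p_m p_(m-1)] evaluates [I m], because
    [L (f) = 0] removes [t]; the recurrence for [I] then eliminates it. *)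
Lemma string_equation (nu t : R) n : (0 < n)%N ->
  (forall f : {poly R},
     L (2%:R *: ('X * f) + 'X^2 * f^`()
        + (- 'X^2 + nu *: 'X + t%:P) * f) = 0) ->
  A n.+1 ^+ 2 * (B n.+1 + B n - nu - 3%:R - 2%:R * n%:R)
  - A n ^+ 2 * (B n + B n.-1 - nu + 1 - 2%:R * n%:R) = B n ^+ 2.
Proof.
move=> n0 pearson.
have IE m : (0 < m)%N -> I m = A m * (B m + B m.-1 - nu - 1 - m%:R).
  case: m => // m _; have := pearson (p m.+1 * p m).
  have -> : 2%:R *: ('X * (p m.+1 * p m)) + 'X^2 * (p m.+1 * p m)^`()
      + (- 'X^2 + nu *: 'X + t%:P) * (p m.+1 * p m)
    = (2%:R + nu) *: ('X * p m.+1 * p m) + 'X^2 * (p m.+1)^`() * p m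
      + 'X^2 * (p m)^`() * p m.+1 - 'X^2 * (p m.+1 * p m) + t *: (p m.+1 * p m).
    by rewrite derivM -!mul_polyC !rmorphD/=; ring.
  rewrite linearD linearB !linearD/= !linearZ/= Lpp gtn_eqF// mulr0 addr0.
  rewrite LX2deriv_top LXpp_succ (LX2pp_pred (ltn0Sn m)) -/(I m.+1)/=.
  by rewrite -[m.+1%:R]natr1; lra.
have := deriv_recurrence n0; rewrite !IE//= -[n.+1%:R]natr1; lra.
Qed.

(** Here [dp] stands for the derivative of [p n] with respect to the parameter
    [t]. The hypothesis is the derivative of [L (p_n p_(n-1)) = 0] in which only
    [L] and [p n] are varied: the derivative of [p n.-1] has degree less than
    [n] and would contribute nothing. On the left of the conclusion is [t] times
    the derivative of the ratio [subratio p n] by the quotient rule. *)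
Lemma toda_equation (nu t : R) n (dp : {poly R}) : (0 < n)%N ->
  (size dp <= n.+1)%N ->
  t * L (dp * p n.-1) + L (laguerre_op nu (p n * p n.-1)) = 0 ->
  t * (dp`_n.-1 * (p n)`_n - (p n)`_n.-1 * dp`_n) / (p n)`_n ^+ 2
  = beta n + A n ^+ 2.
Proof.
case: n => //= n _ szd.
have a0 := lead_neq0 n; have a1 := lead_neq0 n.+1.
have -> : L (dp * p n) = (dp`_n - dp`_n.+1 * beta n.+1) / (p n)`_n.
  by rewrite mulrC ortho_top2.
have -> : laguerre_op nu (p n.+1 * p n)
    = (nu + 1) *: (p n.+1 * p n) + p n * ('X * (p n.+1)^`())
      + p n.+1 * ('X * (p n)^`()) - 'X * p n.+1 * p n.
  by rewrite /laguerre_op derivM -!mul_polyC; ring.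
rewrite [L (_ - _)]linearB !linearD/= [L (_ *: _)]linearZ/=.
rewrite Lpp gtn_eqF// mulr0 add0r LXpp_succ.
rewrite (@ortho_low n.+1) ?(size_Xn_deriv 1)//.
rewrite ortho_top2 ?(size_Xn_deriv 1)//.
rewrite !coefXM /= !coef_deriv.
have -> : (if n == 0 then 0 else (p n.+1)`_n.-1.+1 *+ n.-1.+1)
    = n%:R * (p n.+1)`_n.
  by case: n {a0 a1 szd} => [|n]; rewrite ?mul0r// mulr_natl.
rewrite -[_ *+ n.+1]mulr_natl -natr1 /offdiag /subratio/= => e.
move: (p n)`_n (p n.+1)`_n (p n.+1)`_n.+1 dp`_n dp`_n.+1 a0 a1 e.
move=> c0 c1 c2 d1 d2 c0_neq0 c2_neq0 e.
apply/eqP; rewrite -subr_eq0; apply/eqP.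
(* The difference of the two sides is c0 / c2 times the hypothesis. *)
rewrite -[RHS](mulr0 (c0 / c2)) -e.
by field; rewrite c0_neq0 c2_neq0.
Qed.

End Orthonormal.

(** * The fundamental theorem of calculus on the half-line *)

Section HalfLine.
Variable R : realType.
Local Notation mu := (@lebesgue_measure R).

(** Integrate over the compact intervals [1/(n+2), n+2], which exhaust the
    half-line; as the sign of [f] is arbitrary, the passage to the limit uses
    dominated convergence with bound [|f|]. *)
Lemma Rintegral_FTC_0y (f F : R -> R) (l0 l1 : R) :
  (forall x : R, 0 < x -> {for x, continuous f}) ->
  (forall x : R, 0 < x -> is_derive x 1 F (f x)) ->
  mu.-integrable `]0, +oo[ (EFin \o f) ->
  F x @[x --> 0^'+] --> l0 -> F x @[x --> +oo] --> l1 ->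
  \int[mu]_(x in `]0, +oo[) f x = l1 - l0.
Proof.
move=> cf dF intf F0 F1.
pose J (n : nat) := `[n.+2%:R^-1, n.+2%:R : R]%classic.
have JD n x : J n x -> 0 < x.
  by rewrite /J/= in_itv/= => /andP[+ _]; apply: lt_le_trans; rewrite invr_gt0.
have inv_lt n : n.+2%:R^-1 < n.+2%:R :> R.
  by rewrite (@lt_trans _ _ 1) ?invf_lt1 ?ltr1n.
have FTC n : (\int[mu]_(x in J n) (f x)%:E
    = (F n.+2%:R - F n.+2%:R^-1)%:E)%E.
  have cF : {within J n, continuous F}.
    apply: derivable_within_continuous => x xJ.
    by have [] := dF x (JD n x xJ).
  have [_ L R0] := (continuous_within_itvP _ (inv_lt n)).1 cF.
  rewrite (@continuous_FTC2 _ f F)//.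
  - by apply: continuous_in_subspaceT => x; rewrite inE => /JD/cf.
  - split => // x /subset_itv_oo_cc xJ.
    by have [] := dF x (JD n x xJ).
  - move=> x /subset_itv_oo_cc xJ; rewrite derive1E.
    by have [] := dF x (JD n x xJ).
have mf : measurable_fun (`]0, +oo[%classic : set R) f.
  by apply/measurable_EFinP; case/integrableP: intf.
pose g n := (EFin \o f) \_ (J n).
have intg n : (\int[mu]_(x in `]0%R, +oo[) g n x
    = (F n.+2%:R - F n.+2%:R^-1)%:E)%E.
  rewrite -integral_mkcondr -FTC; congr integral.
  by rewrite setIidr// => x /JD; rewrite /= in_itv/= andbT.
have mJ n : measurable (J n) by exact: measurable_itv.
have [||||||_ _ cvgg] := @dominated_convergence _ _ _ mu `]0, +oo[ _ g
    (EFin \o f) (abse \o EFin \o f).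
- exact: measurable_itv.
- move=> n; apply/measurable_restrict => //; first exact: measurable_itv.
  apply/measurable_EFinP; apply: measurable_funS mf; last exact: subIsetl.
  exact: measurable_itv.
- exact/measurable_EFinP.
- apply/aeW => x; rewrite /= in_itv/= andbT => x0.
  apply: cvg_near_cst; rewrite /=; near=> n.
  have nx : x <= n.+2%:R.
    by rewrite (le_trans (_ : _ <= n%:R)) ?ler_nat 1?ltnW//; near: n;
      exact: nbhs_infty_ger.
  have nVx : x^-1 <= n.+2%:R.
    by rewrite (le_trans (_ : _ <= n%:R)) ?ler_nat 1?ltnW//; near: n;
      exact: nbhs_infty_ger.
  rewrite /g patchE ifT// inE /J/= in_itv/= nx andbT.
  by rewrite invf_ple ?posrE.
- exact: integrable_abse.
- apply/aeW => x n _; rewrite /g patchE; case: ifPn => // _.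
  by rewrite abse0 abse_ge0.
have cvgn2 : (n.+2%:R : R) @[n --> \oo] --> +oo.
  apply/cvgryPge => M; near=> n.
  rewrite (le_trans (_ : _ <= n%:R)) ?ler_nat 1?ltnW//; near: n.
  exact: nbhs_infty_ger.
have cvgF : F n.+2%:R - F n.+2%:R^-1 @[n --> \oo] --> l1 - l0.
  apply: cvgB.
  - apply: (cvg_pinftyP _ _).1 F1 _ _; exact: cvgn2.
  - apply: (cvg_at_rightP _ _ _).1 F0 _ _; split.
      by move=> n; rewrite invr_gt0.
    by apply/gtr0_cvgV0 => //; apply: nearW => n; rewrite ltr0n.
apply: (cvg_unique _ _ cvgF) => //; move: cvgg.
rewrite -[X in _ --> X]fineK; last exact: integrable_fin_num.
move/fine_cvg; apply: cvg_trans; apply: near_eq_cvg; apply: nearW => n /=.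
by rewrite intg.
Unshelve. all: end_near. Qed.

End HalfLine.

(** * The weight: derivatives, bounds and behaviour at the ends *)

Section Weight.
Variables (R : realType) (nu : R).
Local Notation mu := (@lebesgue_measure R).
Local Notation w := (weight nu).
Implicit Types (s t x : R) (q : {poly R}).

Lemma weight_ge0 t x : 0 <= w t x.
Proof. by rewrite mulr_ge0 ?expR_ge0 ?powR_ge0. Qed.

Lemma is_derive_weight t x : 0 < x ->
  is_derive x 1 (w t) ((- 1 + t / x ^+ 2 + nu / x) * w t x).
Proof.
move=> x0.
have dV : is_derive x 1 (fun y : R => y^-1) (- x ^- 2).
  apply: is_derive_eq; first by apply: is_deriveV; rewrite gt_eqF.
  by rewrite /GRing.scale/= mulr1.
have dE : is_derive x 1 (fun y : R => - y - t / y) (- 1 + t / x ^+ 2).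
  apply: is_derive_eq.
  by rewrite scalerN opprK.
have de : is_derive x 1 (fun y : R => expR (- y - t / y))
    ((- 1 + t / x ^+ 2) * expR (- x - t / x)).
  by apply: is_derive_eq; rewrite mulrC.
have := is_deriveM de (is_derive1_powR nu x0).
move/trigger_derive; apply; rewrite /weight /GRing.scale/=.
rewrite powRB ?(gt_eqF x0) ?implybT//.
by rewrite powRr1 ?ltW//; ring.
Qed.

Lemma is_derive_weight_param t x :
  is_derive t 1 (fun s => w s x) (- (w t x / x)).
Proof.
have de : is_derive t 1 (fun s : R => expR (- x - s / x))
    (- x^-1 * expR (- x - t / x)).
  by apply: is_derive_eq; rewrite /GRing.scale/=; ring.
have := is_deriveM de (is_derive_cst (x `^ nu) t 1).
by move/trigger_derive; apply; rewrite /weight /GRing.scale/=; ring.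
Qed.

(** With y = (t - s)/x this is the inequality y <= e^y: lowering the parameter
    pays for a pole of order one at the origin. *)
Lemma weight_div_le s t x : s < t -> 0 < x -> w t x / x <= w s x / (t - s).
Proof.
move=> st x0; have ts : 0 < t - s by rewrite subr_gt0.
have -> : w t x / x = w t x / (t - s) * ((t - s) / x).
  by field; rewrite !gt_eqF.
have -> : w s x / (t - s) = w t x / (t - s) * expR ((t - s) / x).
  rewrite /weight (_ : - x - s / x = (- x - t / x) + (t - s) / x); last by ring.
  by rewrite [in LHS]expRD; ring.
rewrite ler_wpM2l ?divr_ge0 ?weight_ge0 ?(ltW ts)//.
by rewrite (le_trans _ (expR_ge1Dx _))// lerDr.
Qed.

Lemma weight_le s t x : s <= t -> 0 < x -> w t x <= w s x.
Proof.
move=> st x0; rewrite ler_wpM2r ?powR_ge0// ler_expR lerD2l lerN2.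
by rewrite ler_pM2r ?invr_gt0.
Qed.

Lemma continuous_weight t x : 0 < x -> {for x, continuous (w t)}.
Proof.
move=> x0; apply/differentiable_continuous/derivable1_diffP.
by have [] := is_derive_weight t x0.
Qed.

Lemma continuous_horner_weight q t x : 0 < x ->
  {for x, continuous (fun x => q.[x] * w t x)}.
Proof.
move=> x0; apply: continuousM; last exact: continuous_weight.
exact: continuous_horner.
Qed.

Lemma continuous_horner_div_weight q t x : 0 < x ->
  {for x, continuous (fun x => q.[x] / x * w t x)}.
Proof.
move=> x0; apply: continuousM; last exact: continuous_weight.
apply: continuousM; first exact: continuous_horner.
by apply: continuousV; [rewrite gt_eqF|exact: cvg_id].
Qed.

Lemma measurable_fun_pos (f : R -> R) :
  (forall x, 0 < x -> {for x, continuous f}) ->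
  measurable_fun (`]0, +oo[%classic : set R) f.
Proof.
move=> cf; apply: open_continuous_measurable_fun; first exact: interval_open.
by move=> x; rewrite inE/= in_itv/= andbT; exact: cf.
Qed.

(** With [N >= - nu], the power x^nu is at most x^(-N) near the origin, while
    e^(t/x) >= (t/x)^(N+1) / (N+1)!; hence the weight is at most [C x]. *)
Lemma weight_cvg0_at0 t : 0 < t -> w t x @[x --> 0^'+] --> 0.
Proof.
move=> t0; have [N nuN] : exists N : nat, - nu <= N%:R.
  exists (Num.bound `|nu|).
  by rewrite (le_trans (ler_norm _))// normrN ltW// archi_boundP.
pose C := N.+1`!%:R / t ^+ N.+1.
apply: (@squeeze_cvgr _ _ _ _ (cst 0) (fun x => C * x)); last 2 first.
- exact: cvg_cst.
- rewrite -[X in _ --> X](mulr0 C); apply: cvgMr; apply: cvg_at_right_filter.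
  exact: cvg_id.
near=> x; have x0 : 0 < x by [].
have x1 : x <= 1 by near: x; exact: nbhs_right_le.
rewrite weight_ge0/= /weight expRD.
have le1 : expR (- x) <= 1 by rewrite expR_le1 oppr_le0 ltW.
have le2 : expR (- (t / x)) <= N.+1`!%:R * (x / t) ^+ N.+1.
  rewrite expRN invf_ple ?posrE ?expR_gt0 ?mulr_gt0 ?exprn_gt0 ?divr_gt0
    ?ltr0n ?fact_gt0//.
  rewrite invfM -exprVn invf_div mulrC.
  have := expR_ge1Dxn N (ltW (divr_gt0 t0 x0)); lra.
have le3 : x `^ nu <= x ^- N.
  by rewrite -powR_invn ?(ltW x0)//; apply: ger_powR; rewrite ?x0// lerNl.
have -> : C * x = 1 * (N.+1`!%:R * (x / t) ^+ N.+1) * x ^- N.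
  rewrite /C expr_div_n exprS [in X in _ = X]exprS; field.
  by rewrite !expf_neq0 ?gt_eqF.
by rewrite !ler_pM ?mulr_ge0 ?expR_ge0 ?powR_ge0.
Unshelve. all: end_near. Qed.

(** With [N >= nu], e^x >= x^(k+N+1) / (k+N+1)! bounds x^k times the weight by
    [C / x] for [x >= 1]. *)
Lemma exprn_weight_cvg0_aty t k : 0 < t -> x ^+ k * w t x @[x --> +oo] --> 0.
Proof.
move=> t0; have [N nuN] : exists N : nat, nu <= N%:R.
  exists (Num.bound `|nu|).
  by rewrite (le_trans (ler_norm _))// ltW// archi_boundP.
pose C : R := (k + N).+1`!%:R.
apply: (@squeeze_cvgr _ _ _ _ (cst 0) (fun x => C * x^-1)); last 2 first.
- exact: cvg_cst.
- rewrite -[X in _ --> X](mulr0 C); apply: cvgMr.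
  apply/gtr0_cvgV0; last exact: cvg_id.
  exact: nbhs_pinfty_gt.
near=> x; have x1 : 1 <= x by near: x; exact: nbhs_pinfty_ge.
have x0 : 0 < x by rewrite (lt_le_trans ltr01).
rewrite mulr_ge0 ?weight_ge0 ?exprn_ge0 ?(ltW x0)//=.
have le1 : expR (- x - t / x) <= expR (- x).
  by rewrite ler_expR gerBl divr_ge0 ?ltW.
have le2 : x `^ nu <= x ^+ N.
  by rewrite -powR_mulrn ?(ltW x0)//; exact: ler_powR.
have le3 : x ^+ (k + N).+1 * expR (- x) <= C.
  rewrite expRN ler_pdivrMr ?expR_gt0// mulrC -ler_pdivrMr ?ltr0n ?fact_gt0//.
  have := expR_ge1Dxn (k + N) (ltW x0); lra.
have -> : x ^+ k * w t x = x ^+ k.+1 * w t x / x.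
  by rewrite exprS; field; rewrite gt_eqF.
rewrite ler_wpM2r ?invr_ge0 ?(ltW x0)// (le_trans _ le3)//.
rewrite -addSn exprD -mulrA ler_wpM2l ?exprn_ge0 ?(ltW x0)//.
by rewrite mulrC ler_pM ?expR_ge0 ?powR_ge0.
Unshelve. all: end_near. Qed.

Lemma horner_weight_cvg0_aty q t : 0 < t -> q.[x] * w t x @[x --> +oo] --> 0.
Proof.
move=> t0.
suff H k : x ^+ k * (q.[x] * w t x) @[x --> +oo] --> 0.
  by have := H 0%N; under eq_fun do rewrite expr0 mul1r.
elim/poly_ind: q k => [|q c IH] k.
  by under eq_fun do rewrite horner0 mul0r mulr0; exact: cvg_cst.
have -> : (fun x => x ^+ k * ((q * 'X + c%:P).[x] * w t x))
  = (fun x => x ^+ k.+1 * (q.[x] * w t x) + c * (x ^+ k * w t x)).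
  by apply/funext => x; rewrite hornerD hornerMX hornerC exprS; ring.
rewrite -[X in _ --> X](addr0 0) -[X in _ + X](mulr0 c).
by apply: cvgD; [exact: IH|apply: cvgMr; exact: exprn_weight_cvg0_aty].
Qed.

Lemma horner_weight_cvg0_at0 q t : 0 < t -> q.[x] * w t x @[x --> 0^'+] --> 0.
Proof.
move=> t0; rewrite -[X in _ --> X](mulr0 q.[0]); apply: cvgM.
  by apply: cvg_at_right_filter; exact: continuous_horner.
exact: weight_cvg0_at0.
Qed.

End Weight.

(** * The pairing with the weight *)

Section Moments.
Variables (R : realType) (nu : R).
Local Notation mu := (@lebesgue_measure R).
Local Notation w := (weight nu).
Implicit Types (s t x : R) (q : {poly R}).

Lemma integrable_lin (f g : R -> R) (c : R) :
  mu.-integrable `]0, +oo[ (EFin \o f) ->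
  mu.-integrable `]0, +oo[ (EFin \o g) ->
  mu.-integrable `]0, +oo[ (EFin \o (fun x => c * f x + g x)).
Proof.
move=> intf intg.
have -> : EFin \o (fun x => c * f x + g x)
    = (fun x => c%:E * (EFin \o f) x)%E \+ (EFin \o g).
  by apply/funext => x /=; rewrite EFinD EFinM.
by apply: integrableD => //; apply: integrableZl.
Qed.

Lemma integrable_scale (f : R -> R) (c : R) :
  mu.-integrable `]0, +oo[ (EFin \o f) ->
  mu.-integrable `]0, +oo[ (EFin \o (fun x => c * f x)).
Proof.
move=> intf.
have -> : EFin \o (fun x => c * f x) = (fun x => c%:E * (EFin \o f) x)%E.
  by apply/funext => x /=; rewrite EFinM.
by apply: integrableZl.
Qed.

Definition finite_moments t : Prop := forall q : {poly R},
  mu.-integrable `]0, +oo[ (EFin \o (fun x => q.[x] * w t x)).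

Definition pairing t q : R := \int[mu]_(x in `]0, +oo[) (q.[x] * w t x).

(** Each [P_n^2] has a finite integral against the weight, hence so has
    [P_n P_0] by the inequality between the arithmetic and geometric means; as
    [P_0] is a nonzero constant this gives [P_n], and the [P_n] span the
    polynomials. *)
Lemma orthonormal_finite_moments (P : nat -> R -> {poly R}) :
  orthonormal_family nu P -> forall t, 0 < t -> finite_moments t.
Proof.
move=> orthoP t t0; have [sizeP _ PP] := orthoP t t0.
pose good q := mu.-integrable `]0, +oo[ (EFin \o (fun x => q.[x] * w t x)).
have goodZD c q1 q2 : good q1 -> good q2 -> good (c *: q1 + q2).
  rewrite /good => /integrable_lin/[apply]-/(_ c).
  congr integrable; apply/funext => x /=.
  by rewrite hornerD hornerZ; congr EFin; ring.
have meas q : measurable_fun (`]0, +oo[%classic : set R)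
    (fun x => (q.[x] * w t x)%:E).
  apply/measurable_EFinP; apply: measurable_fun_pos => x.
  exact: continuous_horner_weight.
have goodPP n : good (P n t * P n t).
  apply/integrableP; split; first exact: meas.
  rewrite (_ : (\int[_]_(_ in _) _)%E = 1%:E) ?ltry//.
  have := PP n n; rewrite eqxx => <-.
  apply: eq_integral => x _ /=; rewrite hornerM ger0_norm//.
  by rewrite mulr_ge0 ?weight_ge0// -expr2 sqr_ge0.
have goodPP0 n : good (P n t * P 0%N t).
  apply: (le_integrable _ _ _ (goodZD 1 _ _ (goodPP n) (goodPP 0%N))) => //.
    exact: meas.
  move=> x _ /=; rewrite lee_fin !normrM ler_wpM2r// hornerD hornerZ !hornerM.
  set a := (P n t).[x]; set b := (P 0%N t).[x].
  rewrite mul1r [leRHS]ger0_norm ?addr_ge0 -?expr2 ?sqr_ge0//.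
  rewrite ler_norml; have := sqr_ge0 (a + b); have := sqr_ge0 (a - b).
  by rewrite !expr2 => h1 h2; apply/andP; split; nra.
have goodP n : good (P n t).
  have [c c0 P0E] : exists2 c, c != 0 & P 0%N t = c%:P.
    exists (P 0%N t)`_0; last by apply: size1_polyC; rewrite sizeP.
    exact: (@lead_neq0 _ (P^~ t)).
  have := goodZD c^-1 _ _ (goodPP0 n) (goodZD (-1) _ _ (goodPP n) (goodPP n)).
  by rewrite scaleN1r addNr addr0 P0E mulrC mul_polyC scalerA mulVf// scale1r.
suff H k : forall q, (size q <= k)%N -> good q.
  by move=> q; exact: (H (size q)).
elim: k => [q|k IH q szq].
  rewrite leqn0 size_poly_eq0 => /eqP ->.
  have := goodZD (-1) _ _ (goodP 0%N) (goodP 0%N).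
  by rewrite scaleN1r addNr.
pose c := q`_k / (P k t)`_k.
rewrite (_ : q = c *: P k t + (q - c *: P k t)); last by rewrite addrC subrK.
apply: goodZD; first exact: goodP.
by apply: IH; exact: (@size_sub_top _ (P^~ t)).
Qed.

Lemma integrable_div t q : (forall s, 0 < s -> finite_moments s) -> 0 < t ->
  mu.-integrable `]0, +oo[ (EFin \o (fun x => q.[x] / x * w t x)).
Proof.
move=> fm t0; have ht : 0 < t / 2 by rewrite divr_gt0.
have htt : t / 2 < t by lra.
have tht : 0 < t - t / 2 by lra.
apply: (le_integrable _ _ _ (fm _ ht ((t - t / 2)^-1 *: q))) => //=.
  apply/measurable_EFinP; apply: measurable_fun_pos => x.
  exact: continuous_horner_div_weight.
move=> x; rewrite /= in_itv/= andbT lee_fin => x0.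
rewrite hornerZ -!mulrA [_ * (q.[x] * _)]mulrCA !(normrM q.[x]) ler_wpM2l//.
have nonneg c s : 0 < c -> 0 <= c^-1 * w s x.
  by move=> c0; rewrite pmulr_rge0 ?invr_gt0// weight_ge0.
rewrite !ger0_norm ?nonneg//.
by rewrite mulrC [leRHS]mulrC weight_div_le.
Qed.

Lemma pairing_linear t : finite_moments t -> scalar (pairing t).
Proof.
move=> fm c q1 q2; rewrite /pairing -RintegralZl//.
rewrite -RintegralD//; last exact: integrable_scale.
by apply: eq_Rintegral => x _; rewrite hornerD hornerZ mulrDl -mulrA.
Qed.

(** The integral of the derivative of [x q(x) w(x)]. The term [t / x^2] of the
    logarithmic derivative of the weight becomes [t / x] after multiplication
    by [x], so that one pole is left in the integrand. *)
Lemma pairing_by_parts t q : (forall s, 0 < s -> finite_moments s) -> 0 < t ->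
  pairing t (laguerre_op nu q)
  + t * \int[mu]_(x in `]0, +oo[) (q.[x] / x * w t x) = 0.
Proof.
move=> fm t0; rewrite -RintegralZl//; last exact: integrable_div.
have intd :
    mu.-integrable `]0, +oo[ (EFin \o (fun x => t * (q.[x] / x * w t x))).
  by apply: integrable_scale; exact: integrable_div.
rewrite -RintegralD//; last exact: (fm _ t0 _).
rewrite -[RHS](subr0 0).
apply: (@Rintegral_FTC_0y _ _ (fun x => ('X * q).[x] * w t x)).
- have -> : (fun x => (laguerre_op nu q).[x] * w t x
      + t * (q.[x] / x * w t x))
    = (fun x => (laguerre_op nu q).[x] * w t x)
      \+ (fun x => (t *: q).[x] / x * w t x).
    by apply/funext => x /=; rewrite hornerZ -!mulrA.
  move=> x x0; apply: continuousD; first exact: continuous_horner_weight.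
  exact: continuous_horner_div_weight.
- move=> x x0.
  have := is_deriveM (is_derive_poly ('X * q) x) (is_derive_weight nu t x0).
  move/trigger_derive; apply.
  rewrite /laguerre_op /GRing.scale/= derivM derivX mul1r.
  rewrite !(hornerD, hornerN, hornerM, hornerX, hornerZ).
  by field; rewrite gt_eqF.
- have := integrable_lin 1 (fm t t0 (laguerre_op nu q)) intd.
  by congr integrable; apply/funext => x /=; rewrite mul1r.
- exact: horner_weight_cvg0_at0.
- exact: horner_weight_cvg0_aty.
Qed.

(** Differentiation under the integral produces the integral of [- q w / x],
    which the integration by parts turns into a pairing with a polynomial. The
    weight decreases with the parameter, so on [s > t / 2] its value at [t / 2]
    dominates. *)
Lemma derive_pairing t q : (forall s, 0 < s -> finite_moments s) -> 0 < t ->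
  is_derive t 1 (fun s => pairing s q)
    (t^-1 * pairing t (laguerre_op nu q)).
Proof.
move=> fm t0.
pose f s x := q.[x] * w s x.
have df s x : is_derive s 1 (f ^~ x) (- (q.[x] / x * w s x)).
  have := is_deriveM (is_derive_cst q.[x] s 1) (is_derive_weight_param nu s x).
  by move/trigger_derive; apply; rewrite /GRing.scale/=; ring.
have d1 s x : partial1of2 f s x = - (q.[x] / x * w s x).
  by rewrite /partial1of2 derive1E; have [] := df s x.
have It : `]t / 2, t * 2[%classic t.
  by rewrite /= in_itv/=; apply/andP; split; lra.
have ht : 0 < t / 2 by rewrite divr_gt0.
pose G x := `|q.[x] / x * w (t / 2) x|.
have intf s : `]t / 2, t * 2[%classic s ->
    mu.-integrable `]0, +oo[ (EFin \o f s).
  by rewrite /= in_itv/= => /andP[ts _]; exact: (fm _ (lt_trans ht ts)).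
have derf s x : `]t / 2, t * 2[%classic s -> `]0, +oo[%classic x ->
    derivable (f ^~ x) s 1.
  by move=> _ _; have [] := df s x.
have intG : mu.-integrable `]0, +oo[ (EFin \o G).
  exact/integrable_norm/integrable_div.
have G_ub s x : `]t / 2, t * 2[%classic s -> `]0, +oo[%classic x ->
    `|partial1of2 f s x| <= G x.
  rewrite /= !in_itv/= andbT => /andP[ts _] x0.
  rewrite d1 normrN /G (normrM _ (w s x)) (normrM _ (w (t / 2) x)).
  by rewrite ler_wpM2l// !ger0_norm ?weight_ge0// weight_le// ltW.
have G0 x : 0 <= G x by exact: normr_ge0.
have mD : measurable
    (`]0, +oo[%classic : set (g_sigma_algebraType R.-ocitv.-measurable)).
  exact: measurable_itv.
have D1 := @derivable_under_integral _ _ _ mu _ _ mD _ _ _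
  It intf derf _ G0 intG G_ub.
have D2 := @differentiation_under_integral _ _ _ mu _ _ mD _ _ _
  It intf derf _ G0 intG G_ub.
split; first exact: D1.
rewrite -derive1E D2.
under eq_Rintegral do rewrite d1 -mulN1r.
rewrite RintegralZl//; last exact: integrable_div.
have /eqP := pairing_by_parts q fm t0.
by rewrite addr_eq0 => /eqP ->; rewrite mulrN mulKf ?gt_eqF// mulN1r.
Qed.

Lemma pairing_pearson t q : (forall s, 0 < s -> finite_moments s) -> 0 < t ->
  pairing t (2%:R *: ('X * q) + 'X^2 * q^`()
             + (- 'X^2 + nu *: 'X + t%:P) * q) = 0.
Proof.
move=> fm t0; rewrite -(pairing_by_parts ('X * q) fm t0).
have -> : 2%:R *: ('X * q) + 'X^2 * q^`() + (- 'X^2 + nu *: 'X + t%:P) * q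
  = t *: q + laguerre_op nu ('X * q).
  by rewrite /laguerre_op derivM derivX -!mul_polyC !rmorphD/=; ring.
rewrite (pairing_linear (fm t t0)) [LHS]addrC; congr (_ + _ * _).
apply: eq_Rintegral => x; rewrite inE/= in_itv/= andbT => x0.
by rewrite hornerM hornerX; congr (_ * _); field; rewrite gt_eqF.
Qed.

End Moments.

(** * The Toda equation *)

Section Toda.
Variables (R : realType) (nu : R) (P : nat -> R -> {poly R}).
Hypothesis orthoP : orthonormal_family nu P.
Local Notation L := (pairing nu).

Lemma pairing_orthonormal s n m : 0 < s -> L s (P n s * P m s) = (n == m)%:R.
Proof.
move=> s0; have [_ _ PP] := orthoP s0.
rewrite -[RHS]/(fine ((n == m)%:R)%:E) -PP.
by congr fine; apply: eq_integral => x _; rewrite hornerM.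
Qed.

Definition pairing_scalar s (s0 : 0 < s) : {scalar {poly R}} :=
  HB.pack (L s) (GRing.isLinear.Build R {poly R} R *%R (L s)
    (pairing_linear (orthonormal_finite_moments orthoP s0))).

(** Product rule for [L_s (P_n(s) q)], in which both the weight and the
    polynomial depend on [s]: the expansion in monomials reduces it to finitely
    many products of a coefficient and a moment. *)
Lemma is_derive_pairing_coef (t : R) n (q : {poly R}) (dp : nat -> R) :
  0 < t -> (forall i, is_derive t 1 (fun s => (P n s)`_i) (dp i)) ->
  is_derive t 1 (fun s => L s (P n s * q))
    (L t ((\poly_(i < n.+1) dp i) * q)
     + t^-1 * L t (laguerre_op nu (P n t * q))).
Proof.
move=> t0 dP.
pose h (i : 'I_n.+1) s := (P n s)`_i * L s ('X^i * q).
pose D := laguerre_op nu.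
have dh i : is_derive t 1 (h i)
    ((P n t)`_i * (t^-1 * L t (D ('X^i * q))) + dp i * L t ('X^i * q)).
  have := is_deriveM (dP i)
    (derive_pairing ('X^i * q) (orthonormal_finite_moments orthoP) t0).
  by move/trigger_derive; apply; rewrite /GRing.scale/= [dp i * _]mulrC.
have expand s (s0 : 0 < s) (r : nat -> R) q' :
    L s ((\poly_(i < n.+1) r i) * q') = \sum_(i < n.+1) r i * L s ('X^i * q').
  rewrite -[L s]/(pairing_scalar s0 : _ -> _) poly_def mulr_suml linear_sum.
  by apply: eq_bigr => i _; rewrite -scalerAl linearZ.
have PE s : 0 < s -> P n s = \poly_(i < n.+1) (P n s)`_i.
  by move=> s0; have [sizeP _ _] := orthoP s0; rewrite -(sizeP n) coefK.
apply: (near_eq_is_derive (f := \sum_(i < n.+1) h i)).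
  near=> s; have s0 : 0 < s by near: s; exact: lt_nbhsr.
  by rewrite [in RHS]PE// expand// fct_sumE.
apply: trigger_derive (is_derive_sum dh) _.
rewrite big_split/= addrC; congr (_ + _); first by rewrite expand.
have DL : D (P n t * q) = \sum_(i < n.+1) (P n t)`_i *: D ('X^i * q).
  have DZD c r r' : D (c *: r + r') = c *: D r + D r'.
    by rewrite /D /laguerre_op derivD derivZ -!mul_polyC; ring.
  rewrite {1}PE// poly_def mulr_suml; elim/big_rec2: _ => [|i r r' _ IH].
    by rewrite /D /laguerre_op deriv0 scaler0 !mulr0 subr0 addr0.
  by rewrite -scalerAl DZD IH.
rewrite -/D DL -[L t]/(pairing_scalar t0 : _ -> _) linear_sum mulr_sumr.
by apply: eq_bigr => i _; rewrite linearZ/= mulrCA.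
Unshelve. all: end_near. Qed.

Hypothesis C1P : C1_coefficients P.

(** The second factor is kept at the fixed parameter [t]: [L_s (P_n(s) q)]
    vanishes for every [s] as soon as the degree of [q] is less than [n], so the
    derivative of [P_(n-1)] never enters. *)
Lemma toda_subratio (t : R) n : 0 < t -> (0 < n)%N ->
  is_derive t 1 (fun s => coef_b P n s / coef_a P n s)
    (t^-1 * (coef_b P n t / coef_a P n t + coef_A P n t ^+ 2)).
Proof.
move=> t0 n0.
pose dp i : R := (fun s => (P n s)`_i)^`()%classic t.
have dP i : is_derive t 1 (fun s => (P n s)`_i) (dp i).
  by split; [have [] := C1P n i t0 | rewrite /dp derive1E].
have [sizeP _ _] := orthoP t0.
have LPP i j : pairing_scalar t0 (P i t * P j t) = (i == j)%:R.
  exact: pairing_orthonormal.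
have E0 : L t ((\poly_(i < n.+1) dp i) * P n.-1 t)
     + t^-1 * L t (laguerre_op nu (P n t * P n.-1 t)) = 0.
  have [_ <-] := is_derive_pairing_coef (P n.-1 t) t0 dP.
  rewrite (@near_eq_derive _ _ _ _ (cst 0)) ?derive_cst//.
  near=> s; have s0 : 0 < s by near: s; exact: lt_nbhsr.
  have [sizePs _ _] := orthoP s0.
  apply: (@ortho_low _ (pairing_scalar s0) (P^~ s)) => // [i j|].
    exact: pairing_orthonormal.
  by rewrite sizeP prednK.
have a_neq0 : (P n t)`_n != 0 := lead_neq0 sizeP n.
have -> : t^-1 * (coef_b P n t / coef_a P n t + coef_A P n t ^+ 2)
    = (dp n.-1 * (P n t)`_n - (P n t)`_n.-1 * dp n) / (P n t)`_n ^+ 2.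
  have := @toda_equation _ (pairing_scalar t0) (P^~ t) sizeP LPP nu t n
    (\poly_(i < n.+1) dp i) n0 (size_poly _ _).
  rewrite !coef_poly ltnSn ltnS leq_pred => toda.
  rewrite -[_ + _]toda; first by rewrite -[t * _ / _]mulrA mulKf// gt_eqF.
  have := congr1 (fun y => t * y) E0.
  by rewrite /= mulr0 mulrDr mulVKf// gt_eqF.
have := is_deriveM (dP n.-1) (is_deriveV a_neq0 (dP n)).
rewrite (_ : (fun s => coef_b P n s / coef_a P n s)
  = fun s => (P n s)`_n.-1 / (P n s)`_n).
  move/trigger_derive; apply; rewrite /GRing.scale/=.
  by field.
by apply/funext => s; rewrite /coef_b /coef_a; case: (n) n0.
Unshelve. all: end_near. Qed.

Lemma toda_diag (t : R) n : 0 < t -> (0 < n)%N ->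
  t * (coef_B P n)^`()%classic t
  = coef_B P n t + coef_A P n t ^+ 2 - coef_A P n.+1 t ^+ 2.
Proof.
move=> t0 n0; rewrite derive1E.
have [_ ->] := is_deriveB (toda_subratio t0 n0) (toda_subratio t0 (ltn0Sn n)).
by rewrite -mulrBr mulVKf ?gt_eqF// /coef_B; ring.
Qed.

End Toda.

(** * The recurrence relation *)

Theorem theorem7 (R : realType) (nu : R) (P : nat -> R -> {poly R})
    (P_orthonormal : orthonormal_family nu P)
    (P_C1 : C1_coefficients P)
    (t : R) (t_gt0 : 0 < t) (n : nat) (n_gt0 : (0 < n)%N) (x : R) :
  let a := coef_a P in
  let b := coef_b P in
  let A := coef_A P in
  let B := coef_B P in
  (A n.+1 t ^+ 2 + b n.+1 t / a n.+1 t
     + x / 2%:R * (B n t - nu - 1 - 2%:R * n%:R))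
    * (A n.+1 t * (P n.+1 t).[x] + A n t * (P n.-1 t).[x])
  + (x * t * (B n)^`()%classic t
     + A n t ^+ 2 * (B n.-1 t - nu + 1 - 2%:R * n%:R)
     - A n.+1 t ^+ 2 * (B n.+1 t - nu - 3%:R - 2%:R * n%:R)
     - (x - B n t)
       * (A n t ^+ 2 + b n t / a n t
          + x / 2%:R * (B n t - nu - 1 - 2%:R * n%:R)))
    * (P n t).[x] = 0.
Proof.
move=> a b A B.
have [size_P _ _] := P_orthonormal t t_gt0.
pose L := pairing_scalar P_orthonormal t_gt0.
have LPP i j : L (P i t * P j t) = (i == j)%:R by exact: pairing_orthonormal.
have three : x * (P n t).[x]
    = A n.+1 t * (P n.+1 t).[x] + B n t * (P n t).[x] + A n t * (P n.-1 t).[x].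
  have := congr1 (horner^~ x) (three_term size_P LPP n_gt0).
  by rewrite hornerM hornerX !hornerD !hornerZ.
have string : A n.+1 t ^+ 2 * (B n.+1 t + B n t - nu - 3%:R - 2%:R * n%:R)
    - A n t ^+ 2 * (B n t + B n.-1 t - nu + 1 - 2%:R * n%:R) = B n t ^+ 2.
  apply: (string_equation size_P LPP n_gt0 (t := t)) => f.
  exact: pairing_pearson (orthonormal_finite_moments P_orthonormal) t_gt0.
have toda : t * (B n)^`()%classic t = B n t + A n t ^+ 2 - A n.+1 t ^+ 2.
  exact: (toda_diag P_orthonormal).
have betaB : b n t / a n t = B n t + b n.+1 t / a n.+1 t.
  by rewrite /B /coef_B subrK.
have -> : A n.+1 t * (P n.+1 t).[x] + A n t * (P n.-1 t).[x]
  = (x - B n t) * (P n t).[x] by rewrite mulrBl three; ring.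
rewrite betaB -[x * t * _]mulrA toda.
move: (A n.+1 t) (A n t) (B n.+1 t) (B n t) (B n.-1 t) (b n.+1 t / _)
  (P n t).[x] string => A1 A0 B1 B0 B_1 beta1 p string.
(* With the Toda equation the powers of x cancel; what is left is p times the
   difference of the two sides of the string equation. *)
transitivity (p * (B0 ^+ 2 - (A1 ^+ 2 * (B1 + B0 - nu - 3%:R - 2%:R * n%:R)
    - A0 ^+ 2 * (B0 + B_1 - nu + 1 - 2%:R * n%:R)))).
  by field.
by rewrite string subrr mulr0.
Qed.
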